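(* There is an absolute constant $c>0$ such that for all positive integers $n,S,G$ there is a formula on the $n$ input variables $x_1,\dots,x_n$ with formula size at most $S$ and at most $G$ gates, computing a function $f$ with $Q(f)\ge c\min\{n,\sqrt{S},n^{1/2}G^{1/4}\}$.
   Context: A formula on input variables $x_1,\dots,x_n$ is a rooted tree whose leaves are labeled by input variables (the same variable may label many leaves) and whose internal vertices are \textsc{not} gates (fanin 1) or unbounded-fanin \textsc{and}/\textsc{or} gates. The formula size is the number of leaves; the gate count is the number of \textsc{and} and \textsc{or} gates. $Q(f)$ denotes bounded-error quantum query complexity: the minimum number of queries to the oracle $|i,b\rangle\mapsto|i,b\oplus x_i\rangle$ by a quantum algorithm outputting $f(x)$ with probability at least $2/3$ on every input. *)

(* Defs.v *)
From Stdlib Require Import Reals List Bool Arith.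
Open Scope R_scope.

(* Leaves are variables x_i (0-indexed: i < n); NOT gates have fanin 1;
   AND/OR gates have unbounded (but >= 1) fanin: first child + list of further children. *)
Inductive formula : Type :=
| FVar (i : nat)
| FNot (g : formula)
| FAnd (g : formula) (gs : list formula)
| FOr  (g : formula) (gs : list formula).

Fixpoint feval (x : nat -> bool) (F : formula) : bool :=
  match F with
  | FVar i => x i
  | FNot g => negb (feval x g)
  | FAnd g gs => feval x g && forallb (feval x) gs
  | FOr g gs => feval x g || existsb (feval x) gs
  end.

Fixpoint fsize (F : formula) : nat :=
  match F with
  | FVar _ => 1
  | FNot g => fsize g
  | FAnd g gs => fsize g + list_sum (map fsize gs)
  | FOr g gs => fsize g + list_sum (map fsize gs)
  end.

Fixpoint fgates (F : formula) : nat :=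
  match F with
  | FVar _ => 0
  | FNot g => fgates g
  | FAnd g gs => 1 + fgates g + list_sum (map fgates gs)
  | FOr g gs => 1 + fgates g + list_sum (map fgates gs)
  end.

Fixpoint fvars_lt (n : nat) (F : formula) : bool :=
  match F with
  | FVar i => Nat.ltb i n
  | FNot g => fvars_lt n g
  | FAnd g gs => fvars_lt n g && forallb (fvars_lt n) gs
  | FOr g gs => fvars_lt n g && forallb (fvars_lt n) gs
  end.

Record C : Type := mkC { Cre : R; Cim : R }.
Definition C0 : C := mkC 0 0.
Definition C1 : C := mkC 1 0.
Definition Cadd (z w : C) : C := mkC (Cre z + Cre w) (Cim z + Cim w).
Definition Cmul (z w : C) : C :=
  mkC (Cre z * Cre w - Cim z * Cim w) (Cre z * Cim w + Cim z * Cre w).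
Definition Cconj (z : C) : C := mkC (Cre z) (- Cim z).
Definition Cnorm2 (z : C) : R := Cre z * Cre z + Cim z * Cim z.

(* Basis states |i, b, w> : query index i < n, query bit b, workspace w < W. *)
Definition idx : Type := (nat * bool * nat)%type.

Definition basis (n W : nat) : list idx :=
  flat_map (fun i => flat_map (fun b => map (fun w => (i, b, w)) (seq 0 W))
                              (false :: true :: nil))
           (seq 0 n).

Definition idx_eqb (a c : idx) : bool :=
  match a, c with
  | (i, b, w), (j, b', v) => Nat.eqb i j && Bool.eqb b b' && Nat.eqb w v
  end.

Definition Csum (l : list idx) (g : idx -> C) : C :=
  fold_right (fun a acc => Cadd (g a) acc) C0 l.

Definition vec : Type := idx -> C.
Definition mat : Type := idx -> idx -> C.

(* U is unitary on the space spanned by basis n W (finite dimension: U^* U = I) *)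
Definition is_unitary (n W : nat) (U : mat) : Prop :=
  forall a c, In a (basis n W) -> In c (basis n W) ->
    Csum (basis n W) (fun d => Cmul (Cconj (U d a)) (U d c)) =
    (if idx_eqb a c then C1 else C0).

Definition apply (n W : nat) (U : mat) (v : vec) : vec :=
  fun a => Csum (basis n W) (fun c => Cmul (U a c) (v c)).

Definition oracle (x : nat -> bool) (v : vec) : vec :=
  fun a => match a with (i, b, w) => v (i, xorb b (x i), w) end.

Definition init_state : vec :=
  fun a => if idx_eqb a (0%nat, false, 0%nat) then C1 else C0.

Fixpoint run (n W : nat) (Us : nat -> mat) (x : nat -> bool) (k : nat) : vec :=
  match k with
  | O => apply n W (Us O) init_state
  | S k' => apply n W (Us (S k')) (oracle x (run n W Us x k'))
  end.

Definition output_prob (n W : nat) (Us : nat -> mat) (out : idx -> bool)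
    (x : nat -> bool) (T : nat) (b : bool) : R :=
  fold_right (fun a s => (if Bool.eqb (out a) b then Cnorm2 (run n W Us x T a) else 0) + s)
             0 (basis n W).

Definition bounded_error_alg (n : nat) (f : (nat -> bool) -> bool) (T : nat) : Prop :=
  exists (W : nat) (Us : nat -> mat) (out : idx -> bool),
    (forall k, (k <= T)%nat -> is_unitary n (S W) (Us k)) /\
    (forall x : nat -> bool, output_prob n (S W) Us out x T (f x) >= 2/3).

(* Q(f) >= q : every bounded-error algorithm uses at least q queries
   (Q(f) is the minimum such T). *)
Definition Q_ge (n : nat) (f : (nat -> bool) -> bool) (q : R) : Prop :=
  forall T : nat, bounded_error_alg n f T -> q <= INR T.

(* Main.v *)
(* The formula is PARITY_m o AND_k with m = 2^t, where recursive doubling expands the parity into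
   size m^2. The lower bound is an adversary argument: choose each block independently to be
   all ones with probability 1/2, or to have a single zero at a uniform position, and
   track, summed over the blocks b, the average inner product of the states on two inputs
   that differ only in that block b is all ones in the first and has a zero in the
   second. It starts at m and must end below 17m/18. Resampling the block bounds the query
   weight of the first state at the unknown zero position by 2/k on average, and that of the
   second by 2, so by AM-GM one query costs at most 4/sqrt k, whence T >= m sqrt k / 72.
   With N = min(n, S), the largest power of two m subject to m <= N, m N <= S and
   2 m^2 - 1 <= G, together with k = N/m rounded down, gives the three terms of the minimum. *)

Require Import Defs.
From Stdlib Require Import Reals List Bool Arith.
From Stdlib Require Import Lra Lia.
Import ListNotations.
Open Scope R_scope.

(** * Finite real sums over lists *)

Definition rsum {A : Type} (l : list A) (f : A -> R) : R :=
  fold_right (fun a s => f a + s) 0 l.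

Lemma rsum_ext {A} (l : list A) f g :
  (forall a, In a l -> f a = g a) -> rsum l f = rsum l g.
Proof.
  induction l as [|a l IH]; simpl; intros H; auto.
  rewrite (H a) by auto. rewrite IH; auto.
Qed.

Lemma rsum_le {A} (l : list A) f g :
  (forall a, In a l -> f a <= g a) -> rsum l f <= rsum l g.
Proof.
  induction l as [|a l IH]; simpl; intros H; [lra|].
  apply Rplus_le_compat; auto.
Qed.

Lemma rsum_plus {A} (l : list A) f g :
  rsum l (fun a => f a + g a) = rsum l f + rsum l g.
Proof. induction l as [|a l IH]; simpl; [lra|]. rewrite IH; lra. Qed.

Lemma rsum_scal {A} (l : list A) r f :
  rsum l (fun a => r * f a) = r * rsum l f.
Proof. induction l as [|a l IH]; simpl; [lra|]. rewrite IH; lra. Qed.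

Lemma rsum_const {A} (l : list A) r : rsum l (fun _ => r) = INR (length l) * r.
Proof.
  induction l as [|a l IH]; [simpl; lra|].
  cbn [length]. rewrite S_INR. simpl. rewrite IH. ring.
Qed.

Lemma rsum_zero {A} (l : list A) : rsum l (fun _ => 0) = 0.
Proof. rewrite rsum_const; lra. Qed.

Lemma rsum_nonneg {A} (l : list A) f :
  (forall a, In a l -> 0 <= f a) -> 0 <= rsum l f.
Proof. intros H. rewrite <- (rsum_zero l). now apply rsum_le. Qed.

Lemma rsum_ge_term {A} (l : list A) f a :
  (forall c, In c l -> 0 <= f c) -> In a l -> f a <= rsum l f.
Proof.
  induction l as [|c l IH]; simpl; [tauto|].
  intros H [->|Ha].
  - assert (0 <= rsum l f) by (apply rsum_nonneg; auto). lra.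
  - assert (f a <= rsum l f) by auto. specialize (H c (or_introl eq_refl)). lra.
Qed.

Lemma rsum_app {A} (l l' : list A) f : rsum (l ++ l') f = rsum l f + rsum l' f.
Proof. induction l as [|a l IH]; simpl; [lra|]. rewrite IH; lra. Qed.

Lemma rsum_map {A B} (h : A -> B) l f : rsum (map h l) f = rsum l (fun a => f (h a)).
Proof. induction l as [|a l IH]; simpl; auto. now rewrite IH. Qed.

Lemma rsum_flat_map {A B} (h : A -> list B) l f :
  rsum (flat_map h l) f = rsum l (fun a => rsum (h a) f).
Proof. induction l as [|a l IH]; simpl; auto. now rewrite rsum_app, IH. Qed.

Lemma rsum_exchange {A B} (l : list A) (l' : list B) f :
  rsum l (fun a => rsum l' (fun b => f a b)) = rsum l' (fun b => rsum l (fun a => f a b)).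
Proof.
  induction l as [|a l IH]; simpl.
  - now rewrite rsum_zero.
  - now rewrite IH, rsum_plus.
Qed.

Lemma rsum_delta {A} (eqb : A -> A -> bool) (l : list A) a f :
  (forall c d, eqb c d = true <-> c = d) -> NoDup l -> In a l ->
  rsum l (fun c => if eqb a c then f c else 0) = f a.
Proof.
  intros Heq Hnd. induction Hnd as [|c l Hc Hnd IH]; simpl; [tauto|].
  intros [->|Ha].
  - rewrite (proj2 (Heq a a) eq_refl).
    rewrite (rsum_ext l _ (fun _ => 0)); [rewrite rsum_zero; lra|].
    intros d Hd. destruct (eqb a d) eqn:E; auto.
    apply Heq in E; subst; tauto.
  - rewrite IH by auto. destruct (eqb a c) eqn:E; [|lra].
    apply Heq in E; subst; tauto.
Qed.

Lemma rsum_seq_shift o s k f :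
  rsum (seq (o + s) k) f = rsum (seq s k) (fun j => f (o + j)%nat).
Proof.
  revert s; induction k as [|k IH]; intros s; simpl; auto.
  now rewrite <- IH, Nat.add_succ_r.
Qed.

Lemma rsum_seq_mul m k f :
  rsum (seq 0 (m * k)) f = rsum (seq 0 m) (fun b => rsum (seq 0 k) (fun j => f (b * k + j)%nat)).
Proof.
  induction m as [|m IH]; [reflexivity|].
  replace (Nat.mul (S m) k) with (m * k + k)%nat by lia.
  rewrite seq_app, rsum_app, IH, Nat.add_comm, rsum_seq_shift, (seq_S m), rsum_app.
  simpl. ring.
Qed.

Lemma rsum_seq_mono m n f :
  (m <= n)%nat -> (forall i, 0 <= f i) -> rsum (seq 0 m) f <= rsum (seq 0 n) f.
Proof.
  intros Hmn Hf. replace n with (m + (n - m))%nat by lia.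
  rewrite seq_app, rsum_app.
  assert (0 <= rsum (seq (0 + m) (n - m)) f) by (apply rsum_nonneg; auto). lra.
Qed.

(** * The real inner product on states *)

(** The real part of the Hermitian product. Unitaries preserve it and it yields the norms, so the
    progress measure can be kept real. *)
Definition dot (z w : Defs.C) : R := Cre z * Cre w + Cim z * Cim w.

Definition inner (n W : nat) (u v : vec) : R :=
  rsum (basis n W) (fun a => dot (u a) (v a)).

(** The share of [inner] carried by query index [i]; for [u = v] it is the query weight of the state
    at [i]. *)
Definition inner_at (W i : nat) (u v : vec) : R :=
  rsum [false; true] (fun b => rsum (seq 0 W) (fun w => dot (u (i, b, w)) (v (i, b, w)))).

Lemma dot_sqr_nonneg z : 0 <= dot z z.
Proof. unfold dot. nra. Qed.

Lemma dot_sym z w : dot z w = dot w z.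
Proof. unfold dot; ring. Qed.

Lemma dot_young s z w : 0 < s -> 2 * dot z w <= s * dot z z + / s * dot w w.
Proof.
  intros Hs.
  assert (H : forall a b, 2 * (a * b) <= s * (a * a) + / s * (b * b)).
  { intros a b. assert (0 < / s) by now apply Rinv_0_lt_compat.
    assert (s * (a * a) + / s * (b * b) - 2 * (a * b) = / s * ((s * a - b) * (s * a - b)))
      by (field; lra).
    assert (0 <= / s * ((s * a - b) * (s * a - b))) by (apply Rmult_le_pos; [lra | apply Rle_0_sqr]). lra. }
  unfold dot. specialize (H (Cre z) (Cre w)) as H1. specialize (H (Cim z) (Cim w)) as H2. lra.
Qed.

Lemma dot_neg_young s z w : 0 < s -> - (2 * dot z w) <= s * dot z z + / s * dot w w.
Proof.
  intros Hs. pose proof (dot_young s (mkC (- Cre z) (- Cim z)) w Hs) as H.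
  unfold dot in *; simpl in H. lra.
Qed.

Lemma inner_inner_at n W u v :
  inner n W u v = rsum (seq 0 n) (fun i => inner_at W i u v).
Proof.
  unfold inner, inner_at, basis. rewrite rsum_flat_map.
  apply rsum_ext; intros i _. rewrite rsum_flat_map.
  apply rsum_ext; intros b _. now rewrite rsum_map.
Qed.

Lemma inner_at_sqr_nonneg W i u : 0 <= inner_at W i u u.
Proof.
  apply rsum_nonneg; intros b _. apply rsum_nonneg; intros w _. apply dot_sqr_nonneg.
Qed.

Lemma inner_at_young W i s u v : 0 < s ->
  2 * inner_at W i u v <= s * inner_at W i u u + / s * inner_at W i v v.
Proof.
  intros Hs. unfold inner_at. rewrite <- !rsum_scal, <- rsum_plus.
  apply rsum_le; intros b _. rewrite <- !rsum_scal, <- rsum_plus.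
  apply rsum_le; intros w _. now apply dot_young.
Qed.

Lemma inner_at_neg_young W i s u v : 0 < s ->
  - (2 * inner_at W i u v) <= s * inner_at W i u u + / s * inner_at W i v v.
Proof.
  intros Hs. replace (- (2 * inner_at W i u v)) with (-2 * inner_at W i u v) by ring.
  unfold inner_at. rewrite <- !rsum_scal, <- rsum_plus.
  apply rsum_le; intros b _. rewrite <- !rsum_scal, <- rsum_plus.
  apply rsum_le; intros w _. pose proof (dot_neg_young s (u (i, b, w)) (v (i, b, w)) Hs). lra.
Qed.

(** * The computational basis and invariance under unitaries *)

Lemma idx_eqb_eq a c : idx_eqb a c = true <-> a = c.
Proof.
  destruct a as [[i b] w], c as [[j b'] v]; simpl.
  rewrite !andb_true_iff, !Nat.eqb_eq, Bool.eqb_true_iff.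
  split; [intros [[-> ->] ->]; auto | intros H; inversion H; auto].
Qed.

Lemma in_basis n W i b w : In (i, b, w) (basis n W) <-> (i < n)%nat /\ (w < W)%nat.
Proof.
  unfold basis. rewrite in_flat_map. split.
  - intros [i' [Hi H]]. apply in_flat_map in H as [b' [_ H]].
    apply in_map_iff in H as [w' [E Hw]]. inversion E; subst.
    apply in_seq in Hi, Hw. lia.
  - intros [Hi Hw]. exists i. split; [apply in_seq; lia|].
    apply in_flat_map. exists b. split; [destruct b; simpl; auto|].
    apply in_map_iff. exists w. split; auto. apply in_seq; lia.
Qed.

(** Since [key] recovers the element a member was produced from, the lists produced from distinct
    elements are disjoint. *)
Lemma NoDup_flat_map_key {A B} (key : B -> A) (h : A -> list B) l :
  NoDup l -> (forall a, NoDup (h a)) -> (forall a c, In c (h a) -> key c = a) ->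
  NoDup (flat_map h l).
Proof.
  intros Hl Hh Hk. induction Hl as [|a l Ha Hl IH]; simpl; [constructor|].
  apply NoDup_app; auto.
  intros c Hc Hc'. apply in_flat_map in Hc' as [a' [Ha' Hc']].
  apply Hk in Hc, Hc'. congruence.
Qed.

Lemma basis_NoDup n W : NoDup (basis n W).
Proof.
  apply (NoDup_flat_map_key (fun a : idx => fst (fst a))).
  - apply seq_NoDup.
  - intros i. apply (NoDup_flat_map_key (fun a : idx => snd (fst a))).
    + repeat constructor; simpl; intuition discriminate.
    + intros b. apply NoDup_map_NoDup_ForallPairs; [|apply seq_NoDup].
      intros w w' _ _ E. now inversion E.
    + intros b c Hc. apply in_map_iff in Hc as [w [<- _]]. reflexivity.
  - intros i c Hc. apply in_flat_map in Hc as [b [_ Hc]].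
    apply in_map_iff in Hc as [w [<- _]]. reflexivity.
Qed.

Lemma Cre_Csum l g : Cre (Csum l g) = rsum l (fun a => Cre (g a)).
Proof. induction l as [|a l IH]; simpl; auto. now rewrite IH. Qed.

Lemma Cim_Csum l g : Cim (Csum l g) = rsum l (fun a => Cim (g a)).
Proof. induction l as [|a l IH]; simpl; auto. now rewrite IH. Qed.

Lemma dot_Csum_l l g z : dot (Csum l g) z = rsum l (fun a => dot (g a) z).
Proof.
  induction l as [|a l IH]; simpl; [unfold dot; simpl; ring|].
  rewrite <- IH. unfold dot; simpl; ring.
Qed.

Lemma dot_Csum_r l g z : dot z (Csum l g) = rsum l (fun a => dot z (g a)).
Proof. rewrite dot_sym, dot_Csum_l. apply rsum_ext; intros; apply dot_sym. Qed.

(** The real part of the product of [Cconj v * w] and [Cconj p * q]. It isolates the matrix entries,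
    so that summing over rows produces an entry of $U^*U$. *)
Lemma dot_Cmul p q v w :
  dot (Cmul p v) (Cmul q w) =
  dot v w * Cre (Cmul (Cconj p) q)
  + - (Cre v * Cim w - Cim v * Cre w) * Cim (Cmul (Cconj p) q).
Proof. unfold dot; simpl; ring. Qed.

(** Expand both images and move the sum over rows innermost: it becomes the entry of $U^*U$ at [c],
    [e], and the resulting delta collapses the double sum. *)
Lemma unitary_inner n W U u v : is_unitary n W U ->
  inner n W (apply n W U u) (apply n W U v) = inner n W u v.
Proof.
  intros HU. unfold inner, apply. set (l := basis n W) in *.
  transitivity (rsum l (fun c => rsum l (fun e => rsum l (fun d =>
     dot (Cmul (U d c) (u c)) (Cmul (U d e) (v e)))))).
  { rewrite (rsum_ext l _ (fun d => rsum l (fun c => rsum l (fun e =>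
       dot (Cmul (U d c) (u c)) (Cmul (U d e) (v e)))))).
    - rewrite rsum_exchange. apply rsum_ext; intros c _. apply rsum_exchange.
    - intros d _. rewrite dot_Csum_l. apply rsum_ext; intros c _. apply dot_Csum_r. }
  apply rsum_ext; intros c Hc.
  transitivity (rsum l (fun e => if idx_eqb c e then dot (u c) (v e) else 0)).
  2:{ apply (rsum_delta idx_eqb l c (fun e => dot (u c) (v e))); auto using idx_eqb_eq.
      apply basis_NoDup. }
  apply rsum_ext; intros e He.
  pose proof (HU c e Hc He) as M. fold l in M.
  rewrite (rsum_ext l _ _ (fun d _ => dot_Cmul (U d c) (U d e) (u c) (v e))).
  rewrite rsum_plus, !rsum_scal, <- Cre_Csum, <- Cim_Csum, M.
  destruct (idx_eqb c e); simpl; ring.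
Qed.

(** * The effect of one query *)

(** At index [i] both oracles either fix or swap the two query bits, so the same terms are summed in
    another order. *)
Lemma inner_at_oracle_eq W i x y u v : x i = y i ->
  inner_at W i (oracle x u) (oracle y v) = inner_at W i u v.
Proof. intros E. unfold inner_at, oracle; simpl. rewrite E. destruct (y i); simpl; ring. Qed.

Lemma inner_oracle_self n W x u v :
  inner n W (oracle x u) (oracle x v) = inner n W u v.
Proof. rewrite !inner_inner_at. apply rsum_ext; intros i _. now apply inner_at_oracle_eq. Qed.

(** Only index [i] contributes to the difference. Young's inequality bounds its term before and
    after the query, each by half of the right-hand side, because a query leaves the mass of each
    state at [i] unchanged. *)
Lemma inner_oracle_drop n W x y u v i s : (i < n)%nat -> 0 < s ->
  (forall i', i' <> i -> x i' = y i') ->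
  inner n W u v - inner n W (oracle x u) (oracle y v)
  <= s * inner_at W i u u + / s * inner_at W i v v.
Proof.
  intros Hi Hs Hxy. rewrite !inner_inner_at.
  replace (_ - _) with
    (rsum (seq 0 n) (fun i' => inner_at W i' u v - inner_at W i' (oracle x u) (oracle y v))).
  2:{ rewrite (rsum_ext _ _ (fun i' => inner_at W i' u v
        + (-1) * inner_at W i' (oracle x u) (oracle y v))) by (intros; ring).
      rewrite rsum_plus, rsum_scal. ring. }
  rewrite (rsum_ext _ _ (fun i' => if Nat.eqb i i' then
     inner_at W i' u v - inner_at W i' (oracle x u) (oracle y v) else 0)).
  - rewrite rsum_delta; [| apply Nat.eqb_eq | apply seq_NoDup | apply in_seq; lia].
    pose proof (inner_at_young W i s u v Hs) as H1.
    pose proof (inner_at_neg_young W i s (oracle x u) (oracle y v) Hs) as H2.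
    rewrite !(inner_at_oracle_eq W i x x), !(inner_at_oracle_eq W i y y) in H2 by auto.
    lra.
  - intros i' _. destruct (Nat.eqb_spec i i'); auto.
    rewrite inner_at_oracle_eq by auto. ring.
Qed.

Lemma inner_init n W : (1 <= n)%nat -> (1 <= W)%nat -> inner n W init_state init_state = 1.
Proof.
  intros Hn HW. unfold inner.
  rewrite (rsum_ext _ _ (fun a => if idx_eqb (0%nat, false, 0%nat) a then 1 else 0)).
  - apply (rsum_delta idx_eqb _ (0%nat, false, 0%nat) (fun _ => 1));
      [apply idx_eqb_eq | apply basis_NoDup | apply in_basis; lia].
  - intros a _. unfold init_state.
    destruct (idx_eqb a (0%nat, false, 0%nat)) eqn:E.
    + apply idx_eqb_eq in E; subst. simpl. unfold dot; simpl; ring.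
    + destruct (idx_eqb (0%nat, false, 0%nat) a) eqn:E'; [|unfold dot; simpl; ring].
      apply idx_eqb_eq in E'; subst. discriminate.
Qed.

Lemma run_norm n W Us x T : (1 <= n)%nat -> (1 <= W)%nat ->
  (forall k, (k <= T)%nat -> is_unitary n W (Us k)) ->
  inner n W (run n W Us x T) (run n W Us x T) = 1.
Proof.
  intros Hn HW. induction T as [|T IH]; intros HU; simpl; rewrite unitary_inner by auto.
  - now apply inner_init.
  - rewrite inner_oracle_self. apply IH. auto.
Qed.

(* Weighting the components accepted for [b] by [3/4] and the others by [4/3] in Young's
   inequality gives [1/2 * (1/2 + 4/9)] for each of the two states. *)
Lemma final_inner_le n W Us out x y T b : (1 <= n)%nat -> (1 <= W)%nat ->
  (forall k, (k <= T)%nat -> is_unitary n W (Us k)) ->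
  output_prob n W Us out x T b >= 2/3 ->
  output_prob n W Us out y T (negb b) >= 2/3 ->
  inner n W (run n W Us x T) (run n W Us y T) <= 17/18.
Proof.
  intros Hn HW HU Hx Hy.
  pose proof (run_norm n W Us x T Hn HW HU) as Nx.
  pose proof (run_norm n W Us y T Hn HW HU) as Ny.
  unfold inner, output_prob in *.
  change (fold_right _ 0 (basis n W)) with (rsum (basis n W)
    (fun a => if Bool.eqb (out a) b then Cnorm2 (run n W Us x T a) else 0)) in Hx.
  change (fold_right _ 0 (basis n W)) with (rsum (basis n W)
    (fun a => if Bool.eqb (out a) (negb b) then Cnorm2 (run n W Us y T a) else 0)) in Hy.
  set (u := run n W Us x T) in *. set (v := run n W Us y T) in *. set (l := basis n W) in *.
  set (p := rsum l _) in Hx. set (q := rsum l _) in Hy.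
  assert (H : 2 * rsum l (fun a => dot (u a) (v a)) <=
     4/3 * rsum l (fun a => dot (u a) (u a)) + 3/4 * 0 + (3/4 - 4/3) * p
     + (4/3 * rsum l (fun a => dot (v a) (v a)) + (3/4 - 4/3) * q)).
  { unfold p, q. rewrite Rmult_0_r, Rplus_0_r.
    rewrite <- !rsum_scal, <- !rsum_plus. apply rsum_le; intros a _.
    change (Cnorm2 (u a)) with (dot (u a) (u a)). change (Cnorm2 (v a)) with (dot (v a) (v a)).
    pose proof (dot_young (3/4) (u a) (v a) ltac:(lra)) as H1.
    pose proof (dot_young (4/3) (u a) (v a) ltac:(lra)) as H2.
    replace (/ (3/4)) with (4/3) in H1 by field.
    replace (/ (4/3)) with (3/4) in H2 by field.
    destruct (out a), b; simpl; lra. }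
  lra.
Qed.

(** * Averaging over the hard inputs *)

(* [None] has probability [1/2] and each [Some j], [j < k], has probability [1/(2k)]. *)
Definition avg1 (k : nat) (g : option nat -> R) : R :=
  / 2 * g None + / 2 * (/ INR k * rsum (seq 0 k) (fun j => g (Some j))).

(** Expectation over [m] independent draws, one per block. *)
Fixpoint avg (k m : nat) (F : list (option nat) -> R) : R :=
  match m with
  | O => F []
  | S m => avg1 k (fun o => avg k m (fun z => F (o :: z)))
  end.

Fixpoint upd (z : list (option nat)) (b : nat) (o : option nat) : list (option nat) :=
  match z, b with
  | [], _ => []
  | _ :: z, O => o :: z
  | o' :: z, S b => o' :: upd z b o
  end.

Lemma nth_upd_eq z b o : (b < length z)%nat -> nth b (upd z b o) None = o.
Proof. revert b; induction z as [|a z IH]; intros [|b]; simpl; intros; try lia; auto. apply IH; lia. Qed.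

Lemma nth_upd_neq z b b' o : b' <> b -> nth b' (upd z b o) None = nth b' z None.
Proof.
  revert b b'; induction z as [|a z IH]; intros [|b] [|b']; simpl; intros; try lia; auto.
Qed.

Section Average.
Variable k : nat.
Hypothesis k_pos : (1 <= k)%nat.

Let INR_k_pos : 0 < INR k.
Proof. apply lt_0_INR; lia. Qed.

Lemma avg1_le g h : g None <= h None ->
  (forall j, (j < k)%nat -> g (Some j) <= h (Some j)) -> avg1 k g <= avg1 k h.
Proof.
  intros H0 H. unfold avg1.
  assert (rsum (seq 0 k) (fun j => g (Some j)) <= rsum (seq 0 k) (fun j => h (Some j))).
  { apply rsum_le; intros j Hj. apply H. apply in_seq in Hj; lia. }
  assert (0 < / INR k) by now apply Rinv_0_lt_compat. nra.
Qed.

Lemma avg1_ext g h : (forall o, g o = h o) -> avg1 k g = avg1 k h.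
Proof. intros H; apply Rle_antisym; apply avg1_le; intros; rewrite H; lra. Qed.

Lemma avg1_plus g h : avg1 k (fun o => g o + h o) = avg1 k g + avg1 k h.
Proof. unfold avg1. rewrite rsum_plus. ring. Qed.

Lemma avg1_scal r g : avg1 k (fun o => r * g o) = r * avg1 k g.
Proof. unfold avg1. rewrite rsum_scal. ring. Qed.

Lemma avg1_const r : avg1 k (fun _ => r) = r.
Proof. unfold avg1. rewrite rsum_const, length_seq. field. lra. Qed.

Lemma avg_le m F G : (forall z, length z = m -> F z <= G z) -> avg k m F <= avg k m G.
Proof.
  revert F G; induction m as [|m IH]; intros F G H; simpl; [auto|].
  apply avg1_le; intros; apply IH; intros z Hz; apply H; simpl; auto.
Qed.

Lemma avg_ext m F G : (forall z, length z = m -> F z = G z) -> avg k m F = avg k m G.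
Proof. intros H; apply Rle_antisym; apply avg_le; intros; rewrite H; auto; lra. Qed.

Lemma avg_plus m F G : avg k m (fun z => F z + G z) = avg k m F + avg k m G.
Proof.
  revert F G; induction m as [|m IH]; intros F G; simpl; auto.
  rewrite <- avg1_plus. apply avg1_ext; intros; apply IH.
Qed.

Lemma avg_scal m r F : avg k m (fun z => r * F z) = r * avg k m F.
Proof.
  revert F; induction m as [|m IH]; intros F; simpl; auto.
  rewrite <- avg1_scal. apply avg1_ext; intros; apply IH.
Qed.

Lemma avg_const m r : avg k m (fun _ => r) = r.
Proof.
  induction m as [|m IH]; simpl; auto.
  rewrite (avg1_ext _ (fun _ => r)) by auto. apply avg1_const.
Qed.

Lemma avg_rsum {A} m (l : list A) F :
  avg k m (fun z => rsum l (fun a => F a z)) = rsum l (fun a => avg k m (F a)).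
Proof.
  induction l as [|a l IH]; simpl; [apply avg_const|].
  now rewrite avg_plus, IH.
Qed.

Lemma avg_avg1 m F : avg k m (fun z => avg1 k (fun o => F o z)) = avg1 k (fun o => avg k m (F o)).
Proof. unfold avg1. now rewrite avg_plus, !avg_scal, avg_rsum. Qed.

(** By independence, replacing coordinate [b] by a fresh draw does not change the distribution. *)
Lemma avg_resample m b F : (b < m)%nat ->
  avg k m (fun z => avg1 k (fun o => F (upd z b o))) = avg k m F.
Proof.
  revert b F; induction m as [|m IH]; intros b F Hb; [lia|].
  destruct b as [|b]; simpl.
  (* The old first coordinate is overwritten, so its average is over a constant; what remains is an
     exchange of averages. *)
  - rewrite avg1_const. apply (avg_avg1 m (fun o z => F (o :: z))).
  - apply avg1_ext; intros o. apply (IH b (fun z => F (o :: z))). lia.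
Qed.

(** Resample coordinate [b]: the value [None] has probability 1/2, so for nonnegative [F] fixing it
    costs at most a factor 2. The companion bound for [Some] uses the other half. *)
Lemma avg_upd_None_le m b F : (b < m)%nat -> (forall z, 0 <= F z) ->
  avg k m (fun z => F (upd z b None)) <= 2 * avg k m F.
Proof.
  intros Hb HF. rewrite <- (avg_resample m b F Hb), <- avg_scal.
  apply avg_le; intros z _. unfold avg1.
  assert (0 <= rsum (seq 0 k) (fun j => F (upd z b (Some j)))) by (apply rsum_nonneg; auto).
  assert (0 < / INR k) by now apply Rinv_0_lt_compat. nra.
Qed.

Lemma avg_upd_Some_le m b F : (b < m)%nat -> (forall z, 0 <= F z) ->
  avg k m (fun z => / INR k * rsum (seq 0 k) (fun j => F (upd z b (Some j)))) <= 2 * avg k m F.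
Proof.
  intros Hb HF. rewrite <- (avg_resample m b F Hb), <- avg_scal.
  apply avg_le; intros z _. unfold avg1. pose proof (HF (upd z b None)). lra.
Qed.

End Average.

(* The input encoded by [z] is all ones, except that block [b] has a zero at position [j]
   when [z] has [Some j] at [b]. *)
Definition input (k : nat) (z : list (option nat)) (i : nat) : bool :=
  match nth (i / k) z None with
  | Some j => negb (Nat.eqb (i mod k) j)
  | None => true
  end.

Lemma div_mod_block k b j : (j < k)%nat -> ((b * k + j) / k = b /\ (b * k + j) mod k = j)%nat.
Proof.
  intros Hj. split.
  - rewrite Nat.div_add_l by lia. rewrite Nat.div_small; lia.
  - rewrite Nat.add_comm, Nat.Div0.mod_add. now apply Nat.mod_small.
Qed.

Lemma input_upd_None k z b j : (b < length z)%nat -> (j < k)%nat ->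
  input k (upd z b None) (b * k + j) = true.
Proof.
  intros Hb Hj. destruct (div_mod_block k b j Hj) as [E _].
  unfold input. now rewrite E, nth_upd_eq.
Qed.

Lemma input_upd_Some k z b j : (b < length z)%nat -> (j < k)%nat ->
  input k (upd z b (Some j)) (b * k + j) = false.
Proof.
  intros Hb Hj. destruct (div_mod_block k b j Hj) as [E E'].
  unfold input. now rewrite E, E', nth_upd_eq, Nat.eqb_refl.
Qed.

Lemma input_upd_agree k z b j i : (b < length z)%nat -> (1 <= k)%nat -> i <> (b * k + j)%nat ->
  input k (upd z b None) i = input k (upd z b (Some j)) i.
Proof.
  intros Hb Hk Hi. unfold input.
  destruct (Nat.eq_dec (i / k) b) as [E|E].
  - rewrite E, !nth_upd_eq by auto.
    destruct (Nat.eqb_spec (i mod k) j) as [E'|]; auto.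
    exfalso; apply Hi. subst. pose proof (Nat.div_mod_eq i k). lia.
  - now rewrite !nth_upd_neq.
Qed.

(** * The adversary bound *)

Section Adversary.
Variables (n m k W : nat) (Us : nat -> mat).
Hypotheses (n_pos : (1 <= n)%nat) (k_pos : (1 <= k)%nat) (W_pos : (1 <= W)%nat)
  (mk_le : (m * k <= n)%nat).

Let psi (t : nat) (z : list (option nat)) : vec := run n W Us (input k z) t.

(** Coordinate [b] of [z] is overwritten in both states, so the two inputs of a pair differ exactly
    at position [b * k + j]. *)
Definition progress (t : nat) : R :=
  rsum (seq 0 m) (fun b => avg k m (fun z => / INR k * rsum (seq 0 k) (fun j =>
    inner n W (psi t (upd z b None)) (psi t (upd z b (Some j)))))).

Let block_mass (t b : nat) (z : list (option nat)) : R :=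
  rsum (seq 0 k) (fun j => inner_at W (b * k + j) (psi t z) (psi t z)).

(** Query weight at the zero of block [b], with value 0 when [z] puts no zero inside that block. *)
Let zero_mass (t b : nat) (z : list (option nat)) : R :=
  match nth b z None with
  | Some j => if Nat.ltb j k then inner_at W (b * k + j) (psi t z) (psi t z) else 0
  | None => 0
  end.

Let INR_k_pos : 0 < INR k.
Proof. apply lt_0_INR; lia. Qed.

Let block_mass_nonneg t b z : 0 <= block_mass t b z.
Proof. apply rsum_nonneg; intros; apply inner_at_sqr_nonneg. Qed.

Let zero_mass_nonneg t b z : 0 <= zero_mass t b z.
Proof.
  unfold zero_mass. destruct (nth b z None) as [j|]; [|lra].
  destruct (Nat.ltb j k); [apply inner_at_sqr_nonneg | lra].
Qed.

Let zero_mass_le t b z : zero_mass t b z <= block_mass t b z.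
Proof.
  unfold zero_mass. destruct (nth b z None) as [j|]; [|apply block_mass_nonneg].
  destruct (Nat.ltb_spec j k); [|apply block_mass_nonneg].
  apply (rsum_ge_term _ (fun j => inner_at W (b * k + j) (psi t z) (psi t z))).
  - intros; apply inner_at_sqr_nonneg.
  - apply in_seq; lia.
Qed.

(** The blocks are disjoint ranges of indices below [n], and the state has norm 1. *)
Let block_mass_sum t z : (forall k, (k <= t)%nat -> is_unitary n W (Us k)) ->
  rsum (seq 0 m) (fun b => block_mass t b z) <= 1.
Proof.
  intros HU. unfold block_mass.
  rewrite <- (rsum_seq_mul m k (fun i => inner_at W i (psi t z) (psi t z))).
  rewrite <- (run_norm n W Us (input k z) t) by auto.
  rewrite inner_inner_at. apply rsum_seq_mono; auto.
  intros; apply inner_at_sqr_nonneg.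
Qed.

Let avg_mass_sum t (F : nat -> list (option nat) -> R) :
  (forall k, (k <= t)%nat -> is_unitary n W (Us k)) ->
  (forall b z, F b z <= block_mass t b z) ->
  rsum (seq 0 m) (fun b => avg k m (F b)) <= 1.
Proof.
  intros HU HF. rewrite <- avg_rsum by auto. rewrite <- (avg_const k k_pos m 1).
  apply avg_le; auto. intros z _.
  apply Rle_trans with (2 := block_mass_sum t z HU). apply rsum_le; auto.
Qed.

(** Each pair loses at most the weighted masses of its two states at [b * k + j]. The first state
    does not depend on [j], so averaging over [j] leaves 1/k of its block mass; the second may
    concentrate on its own zero, so [zero_mass] is kept whole. *)
Lemma progress_step t : (forall k, (k <= S t)%nat -> is_unitary n W (Us k)) ->
  progress t - progress (S t) <= 4 / sqrt (INR k).
Proof.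
  intros HU.
  (* This weight balances the two losses: [s * 2 / k] and [2 / s] are equal. *)
  set (s := sqrt (INR k)).
  assert (Hs : 0 < s) by now apply sqrt_lt_R0.
  assert (Hss : s * s = INR k) by (apply sqrt_sqrt; lra).
  assert (Hk' : 0 < / INR k) by now apply Rinv_0_lt_compat.
  assert (Hs' : 0 < / s) by now apply Rinv_0_lt_compat.
  enough (H : progress t <= progress (S t)
     + (s * / INR k * rsum (seq 0 m) (fun b => avg k m (fun z => block_mass t b (upd z b None)))
     + / s * rsum (seq 0 m) (fun b => avg k m (fun z =>
         / INR k * rsum (seq 0 k) (fun j => zero_mass t b (upd z b (Some j))))))).
  { assert (H1 : rsum (seq 0 m) (fun b => avg k m (fun z => block_mass t b (upd z b None))) <= 2).
    { apply Rle_trans with (rsum (seq 0 m) (fun b => 2 * avg k m (block_mass t b))).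
      - apply rsum_le; intros b Hb. apply in_seq in Hb. apply avg_upd_None_le; auto; lia.
      - rewrite rsum_scal. assert (H1 := avg_mass_sum t (block_mass t)
          (fun i Hi => HU i (le_S _ _ Hi)) (fun b z => Rle_refl _)). lra. }
    assert (H2 : rsum (seq 0 m) (fun b => avg k m (fun z =>
         / INR k * rsum (seq 0 k) (fun j => zero_mass t b (upd z b (Some j))))) <= 2).
    { apply Rle_trans with (rsum (seq 0 m) (fun b => 2 * avg k m (zero_mass t b))).
      - apply rsum_le; intros b Hb. apply in_seq in Hb. apply avg_upd_Some_le; auto; lia.
      - rewrite rsum_scal. assert (H2 := avg_mass_sum t (zero_mass t)
          (fun i Hi => HU i (le_S _ _ Hi)) (zero_mass_le t)). lra. }
    replace (s * / INR k) with (/ s) in H by (rewrite <- Hss; field; lra).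
    unfold Rdiv. nra. }
  unfold progress. rewrite <- !rsum_scal, <- !rsum_plus.
  apply rsum_le; intros b Hb. apply in_seq in Hb.
  rewrite <- !avg_scal, <- !avg_plus by auto. apply avg_le; auto. intros z Hz.
  unfold block_mass.
  (* The common factor 1/k is pulled out of all terms so that the comparison can be made for each
     [j] separately. *)
  replace (s * / INR k * _) with (/ INR k * (s * rsum (seq 0 k) (fun j =>
    inner_at W (b * k + j) (psi t (upd z b None)) (psi t (upd z b None))))) by ring.
  replace (/ s * (/ INR k * _)) with (/ INR k * (/ s * rsum (seq 0 k) (fun j =>
    zero_mass t b (upd z b (Some j))))) by ring.
  rewrite <- !Rmult_plus_distr_l. apply Rmult_le_compat_l; [lra|].
  rewrite <- !rsum_scal, <- !rsum_plus.
  apply rsum_le; intros j Hj. apply in_seq in Hj.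
  unfold zero_mass. rewrite nth_upd_eq by lia.
  destruct (Nat.ltb_spec j k); [|lia].
  (* These are the two states at time [S t]; their last unitary cancels, which leaves only the
     oracle calls. *)
  unfold psi at 3 4. simpl. rewrite unitary_inner by auto.
  assert (Hi : (b * k + j < n)%nat) by nia.
  pose proof (inner_oracle_drop n W (input k (upd z b None)) (input k (upd z b (Some j)))
    (psi t (upd z b None)) (psi t (upd z b (Some j))) (b * k + j) s Hi Hs) as D.
  specialize (D (fun i Hi => input_upd_agree k z b j i ltac:(lia) k_pos Hi)).
  unfold psi in *. lra.
Qed.

Lemma progress_init : (forall k, (k <= 0)%nat -> is_unitary n W (Us k)) -> progress 0 = INR m.
Proof.
  intros HU. unfold progress.
  rewrite (rsum_ext _ _ (fun _ => 1)); [rewrite rsum_const, length_seq; ring|].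
  intros b _. rewrite <- (avg_const k k_pos m 1). apply avg_ext; auto. intros z _.
  rewrite (rsum_ext _ _ (fun _ => 1)).
  - rewrite rsum_const, length_seq. field. lra.
  (* Before the first query the state is the same for all inputs, so every inner product is a
     squared norm. *)
  - intros j _. apply (run_norm n W Us (input k z) 0); auto.
Qed.

Lemma progress_lower t : (forall k, (k <= t)%nat -> is_unitary n W (Us k)) ->
  INR m - INR t * (4 / sqrt (INR k)) <= progress t.
Proof.
  induction t as [|t IH]; intros HU.
  - rewrite progress_init by auto. simpl; lra.
  - pose proof (progress_step t HU). specialize (IH ltac:(auto)).
    rewrite S_INR. lra.
Qed.

Lemma progress_final f out T : (forall k, (k <= T)%nat -> is_unitary n W (Us k)) ->
  (forall x, output_prob n W Us out x T (f x) >= 2/3) ->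
  (forall z b j, length z = m -> (b < m)%nat -> (j < k)%nat ->
     f (input k (upd z b None)) = negb (f (input k (upd z b (Some j))))) ->
  progress T <= 17/18 * INR m.
Proof.
  intros HU Hf Hsens. unfold progress.
  apply Rle_trans with (rsum (seq 0 m) (fun _ => 17/18));
    [|rewrite rsum_const, length_seq; lra].
  apply rsum_le; intros b Hb. apply in_seq in Hb.
  rewrite <- (avg_const k k_pos m (17/18)). apply avg_le; auto. intros z Hz.
  apply Rle_trans with (/ INR k * rsum (seq 0 k) (fun _ => 17/18)).
  - apply Rmult_le_compat_l; [left; now apply Rinv_0_lt_compat|].
    apply rsum_le; intros j Hj. apply in_seq in Hj.
    apply final_inner_le with (out := out) (b := negb (f (input k (upd z b (Some j))))); auto.
    + rewrite <- Hsens by (auto; lia). apply Hf.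
    + rewrite negb_involutive. apply Hf.
  - rewrite rsum_const, length_seq. right. field. lra.
Qed.

End Adversary.

Lemma adversary_bound n m k f : (1 <= n)%nat -> (1 <= k)%nat -> (m * k <= n)%nat ->
  (forall z b j, length z = m -> (b < m)%nat -> (j < k)%nat ->
     f (input k (upd z b None)) = negb (f (input k (upd z b (Some j))))) ->
  Q_ge n f (/ 72 * (INR m * sqrt (INR k))).
Proof.
  intros Hn Hk Hmk Hsens T [W [Us [out [HU Hf]]]].
  assert (HW : (1 <= S W)%nat) by lia.
  pose proof (progress_lower n m k _ Us Hn Hk HW Hmk T HU) as H1.
  pose proof (progress_final n m k _ Us Hn Hk HW Hmk f out T HU Hf Hsens) as H2.
  assert (Hs : 0 < sqrt (INR k)) by (apply sqrt_lt_R0, lt_0_INR; lia).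
  (* The progress is at least [m - 4T / sqrt k] and at most [17m / 18]; multiplying by [sqrt k] then
     gives the factor 72 = 18 * 4. *)
  assert (H3 : INR m / 18 <= INR T * (4 / sqrt (INR k))) by lra.
  apply (Rmult_le_compat_r (sqrt (INR k))) in H3; [|lra].
  replace (INR T * (4 / sqrt (INR k)) * sqrt (INR k)) with (4 * INR T) in H3 by (field; lra).
  lra.
Qed.

(** * The formula *)

Definition block_and (k b : nat) : formula :=
  FAnd (FVar (b * k)) (map FVar (seq (b * k + 1) (k - 1))).

(** The parity of blocks [b] to [b + 2^t - 1], through the usual formula for the exclusive or of two
    halves. Each half is copied twice, so the size quadruples at each level. *)
Fixpoint parity_of_ands (k t b : nat) : formula :=
  match t with
  | O => block_and k b
  | S t =>
      let p := parity_of_ands k t b in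
      let q := parity_of_ands k t (b + 2 ^ t) in
      FOr (FAnd p [FNot q]) [FAnd (FNot p) [q]]
  end.

Lemma list_sum_map_const {A} (h : A -> nat) r l :
  (forall a, h a = r) -> list_sum (map h l) = (length l * r)%nat.
Proof. intros H. induction l as [|a l IH]; simpl; auto. Qed.

Lemma fsize_parity k t b : (1 <= k)%nat -> fsize (parity_of_ands k t b) = (4 ^ t * k)%nat.
Proof.
  intros Hk. revert b; induction t as [|t IH]; intros b.
  - simpl. rewrite map_map, (list_sum_map_const _ 1), length_seq by auto. lia.
  - simpl. rewrite !IH. lia.
Qed.

(** The gate count satisfies g' = 4g + 3, so g + 1 quadruples; adding 1 on the left also avoids
    truncated subtraction. *)
Lemma fgates_parity k t b : (fgates (parity_of_ands k t b) + 1 = 2 * 4 ^ t)%nat.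
Proof.
  revert b; induction t as [|t IH]; intros b.
  - simpl. rewrite map_map, (list_sum_map_const _ 0) by auto. lia.
  - pose proof (IH b). pose proof (IH (b + 2 ^ t)%nat). simpl. lia.
Qed.

Lemma fvars_lt_parity n k t b : (1 <= k)%nat -> ((b + 2 ^ t) * k <= n)%nat ->
  fvars_lt n (parity_of_ands k t b) = true.
Proof.
  intros Hk. revert b; induction t as [|t IH]; intros b Hb; simpl in *.
  - apply andb_true_iff; split; [apply Nat.ltb_lt; nia|].
    apply forallb_forall. intros F HF. apply in_map_iff in HF as [i [<- Hi]].
    apply in_seq in Hi. apply Nat.ltb_lt. nia.
  - rewrite !IH by nia. reflexivity.
Qed.

Lemma feval_block_and x k b : (1 <= k)%nat ->
  feval x (block_and k b) = true <->
  forall i, (b * k <= i < (b + 1) * k)%nat -> x i = true.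
Proof.
  intros Hk. simpl. rewrite andb_true_iff, forallb_forall. split.
  - intros [H0 H] i Hi. destruct (Nat.eq_dec i (b * k)) as [->|]; auto.
    apply (H (FVar i)). apply in_map, in_seq. lia.
  - intros H. split; [apply H; lia|].
    intros F HF. apply in_map_iff in HF as [i [<- Hi]]. apply in_seq in Hi.
    apply H. lia.
Qed.

Lemma feval_block_and_ext x y k b : (1 <= k)%nat ->
  (forall i, (b * k <= i < (b + 1) * k)%nat -> x i = y i) ->
  feval x (block_and k b) = feval y (block_and k b).
Proof.
  intros Hk H. apply eq_true_iff_eq. rewrite !feval_block_and by auto.
  split; intros H' i Hi; [rewrite <- H by lia | rewrite H by lia]; auto.
Qed.

(** Passing from [x] to [y] flips the AND of block [b0] and no other, so the parity of a range of
    blocks flips exactly when the range contains [b0]. *)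
Lemma feval_parity_sensitive x y k b0 j0 : (j0 < k)%nat ->
  (forall i, i <> (b0 * k + j0)%nat -> x i = y i) ->
  (forall j, (j < k)%nat -> x (b0 * k + j)%nat = true) ->
  y (b0 * k + j0)%nat = false ->
  forall t b, feval x (parity_of_ands k t b) =
    xorb (Nat.leb b b0 && Nat.ltb b0 (b + 2 ^ t)) (feval y (parity_of_ands k t b)).
Proof.
  intros Hj0 Hxy Hx Hy. induction t as [|t IH]; intros b.
  - destruct (Nat.eq_dec b b0) as [->|Hb].
    + replace (Nat.leb b0 b0 && Nat.ltb b0 (b0 + 2 ^ 0)) with true.
      2:{ symmetry; apply andb_true_iff; split;
          [apply Nat.leb_le | apply Nat.ltb_lt; simpl]; lia. }
      cbn [parity_of_ands].
      replace (feval x (block_and k b0)) with true.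
      2:{ symmetry; apply feval_block_and; [lia|]. intros i Hi.
          replace i with (b0 * k + (i - b0 * k))%nat by lia. apply Hx. lia. }
      replace (feval y (block_and k b0)) with false; auto.
      symmetry; apply not_true_iff_false. rewrite feval_block_and by lia. intros H.
      rewrite H in Hy; [discriminate | lia].
    + replace (Nat.leb b b0 && Nat.ltb b0 (b + 2 ^ 0)) with false.
      2:{ symmetry; apply andb_false_iff.
          destruct (Nat.leb_spec b b0); auto. right. apply Nat.ltb_ge. simpl. lia. }
      rewrite xorb_false_l. apply feval_block_and_ext; [lia|].
      intros i Hi. apply Hxy. nia.
  - cbn [parity_of_ands feval forallb existsb].
    rewrite (IH b), (IH (b + 2 ^ t)%nat).
    (* The range is the disjoint union of its halves, so membership of [b0] is the exclusive or of
       the two memberships. *)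
    replace (Nat.leb b b0 && Nat.ltb b0 (b + 2 ^ S t)) with
      (xorb (Nat.leb b b0 && Nat.ltb b0 (b + 2 ^ t))
            (Nat.leb (b + 2 ^ t) b0 && Nat.ltb b0 (b + 2 ^ t + 2 ^ t))).
    + destruct (feval y (parity_of_ands k t b)), (feval y (parity_of_ands k t (b + 2 ^ t))),
        (Nat.leb b b0 && Nat.ltb b0 (b + 2 ^ t)),
        (Nat.leb (b + 2 ^ t) b0 && Nat.ltb b0 (b + 2 ^ t + 2 ^ t)); reflexivity.
    + pose proof (Nat.pow_nonzero 2 t ltac:(lia)). rewrite Nat.pow_succ_r'.
      destruct (Nat.leb_spec b b0), (Nat.ltb_spec b0 (b + 2 ^ t)),
        (Nat.leb_spec (b + 2 ^ t) b0), (Nat.ltb_spec b0 (b + 2 ^ t + 2 ^ t)),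
        (Nat.ltb_spec b0 (b + 2 * 2 ^ t)); simpl; auto; lia.
Qed.

Lemma parity_of_ands_Q_ge n k t : (1 <= n)%nat -> (1 <= k)%nat -> (2 ^ t * k <= n)%nat ->
  Q_ge n (fun x => feval x (parity_of_ands k t 0)) (/ 72 * (INR (2 ^ t) * sqrt (INR k))).
Proof.
  intros Hn Hk Hle. apply adversary_bound; auto.
  intros z b j Hz Hb Hj.
  rewrite (feval_parity_sensitive (input k (upd z b None)) (input k (upd z b (Some j))) k b j); auto.
  - replace (Nat.leb 0 b && Nat.ltb b (0 + 2 ^ t)) with true; auto.
    symmetry. now apply Nat.ltb_lt.
  - intros i Hi. apply input_upd_agree; auto; lia.
  - intros; apply input_upd_None; auto; lia.
  - apply input_upd_Some; auto; lia.
Qed.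

(** * Choice of the parameters and the final bound *)

Lemma exists_last_true (P : nat -> bool) N : P 0%nat = true -> P N = false ->
  exists t, P t = true /\ P (t + 1)%nat = false.
Proof.
  induction N as [|N IH]; intros H0 HN; [congruence|].
  destruct (P N) eqn:E; auto. exists N. now rewrite Nat.add_1_r.
Qed.

Lemma choose_parameters n s g : (1 <= n)%nat -> (1 <= s)%nat -> (1 <= g)%nat ->
  exists t k, (1 <= k /\ 2 ^ t * k <= n /\ 4 ^ t * k <= s /\ 2 * 4 ^ t <= g + 1 /\
    (n * n <= 9 * (4 ^ t * k) \/ s <= 9 * (4 ^ t * k) \/
     (g <= 9 * 4 ^ t /\ 3 * 2 ^ t * n <= 9 * (4 ^ t * k))))%nat.
Proof.
  intros Hn Hs Hg. set (N := Nat.min n s).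
  assert (Pow : forall t, (4 ^ t = 2 ^ t * 2 ^ t)%nat).
  { intros t. change 4%nat with (2 * 2)%nat. apply Nat.pow_mul_l. }
  (* The three conditions hold at 0 and fail at [N], since [N < 2^N]. With [M = 2^t], failure at
     [t + 1] means [2M > N], [2MN > s] or [8M^2 > g + 1]. *)
  destruct (exists_last_true (fun t => Nat.leb (2 ^ t) N && (Nat.leb (2 ^ t * N) s
     && Nat.leb (2 * (2 ^ t * 2 ^ t)) (g + 1))) N) as [t [Ht Ht']].
  - cbn [Nat.pow]. rewrite !andb_true_iff, !Nat.leb_le. unfold N. lia.
  - apply andb_false_iff. left. apply Nat.leb_gt. apply Nat.pow_gt_lin_r. lia.
  - rewrite !andb_true_iff, !Nat.leb_le in Ht. rewrite !andb_false_iff, !Nat.leb_gt in Ht'.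
    rewrite Nat.pow_add_r in Ht'. change (2 ^ 1)%nat with 2%nat in Ht'.
    exists t, (N / 2 ^ t)%nat. rewrite Pow.
    set (M := (2 ^ t)%nat) in *.
    assert (HM : (1 <= M)%nat) by (pose proof (Nat.pow_nonzero 2 t ltac:(lia)); unfold M; lia).
    pose proof (Nat.div_mod_eq N M) as E. pose proof (Nat.mod_upper_bound N M ltac:(lia)) as E'.
    set (k := (N / M)%nat) in *.
    assert (Hk : (1 <= k)%nat) by nia.
    (* As [k >= 1], rounding [N / M] down loses less than a factor 2. *)
    assert (H2 : (N <= 2 * (M * k))%nat) by nia.
    assert (H3 : (M * N <= 2 * (M * M * k))%nat) by nia.
    (* If [2M > N] then [N^2 <= 4M^2 k], which settles both [N = n] and [N = s]. If [2MN > s] then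
       [s <= 4M^2 k]. If [8M^2 > g + 1], the third alternative holds for [N = n], and for [N = s]
       already [s <= 2M^2 k]. *)
    repeat split; nia.
Qed.

Theorem theorem3 :
  exists c : R, 0 < c /\
    forall n S G : nat, (1 <= n)%nat -> (1 <= S)%nat -> (1 <= G)%nat ->
      exists F : formula,
        fvars_lt n F = true /\ (fsize F <= S)%nat /\ (fgates F <= G)%nat /\
        Q_ge n (fun x => feval x F)
          (c * Rmin (INR n) (Rmin (sqrt (INR S)) (sqrt (INR n) * Rpower (INR G) (/ 4)))).
Proof.
  (* 216 = 72 * 3: the adversary constant times the factor 3 lost in choosing the parameters. *)
  exists (/ 216). split; [lra|]. intros n S G Hn HS HG.
  destruct (choose_parameters n S G Hn HS HG) as [t [k [Hk [Hnk [HSk [HGk Hcase]]]]]].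
  exists (parity_of_ands k t 0).
  split; [now apply fvars_lt_parity|].
  split; [now rewrite fsize_parity|].
  split; [pose proof (fgates_parity k t 0); lia|].
  intros T HT. apply (parity_of_ands_Q_ge n k t Hn Hk Hnk) in HT.
  apply Rle_trans with (2 := HT).
  set (q := INR (2 ^ t) * sqrt (INR k)).
  assert (Hq : 0 <= q) by (apply Rmult_le_pos; [apply pos_INR | apply sqrt_pos]).
  assert (Hq2 : q * q = INR (4 ^ t * k)).
  { unfold q. replace (4 ^ t)%nat with (2 ^ t * 2 ^ t)%nat.
    - rewrite !mult_INR. pose proof (sqrt_sqrt (INR k) (pos_INR k)) as E.
      rewrite <- E at 3. ring.
    - change 4%nat with (2 * 2)%nat. now rewrite Nat.pow_mul_l. }
  enough (Rmin (INR n) (Rmin (sqrt (INR S)) (sqrt (INR n) * Rpower (INR G) (/ 4))) <= 3 * q)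
    by lra.
  (* All three cases compare squares, where the factor 3 becomes the 9 of [choose_parameters]. *)
  assert (Sq : forall a, a * a <= 9 * INR (4 ^ t * k) -> a <= 3 * q).
  { intros a Ha. rewrite <- Hq2 in Ha. apply Rsqr_incr_0_var; [unfold Rsqr|]; lra. }
  assert (E9 : INR 9 = 9) by (simpl; ring).
  destruct Hcase as [H|[H|[H H']]].
  - apply Rle_trans with (1 := Rmin_l _ _). apply Sq.
    apply le_INR in H. rewrite (mult_INR n), (mult_INR 9), E9 in H. lra.
  - apply Rle_trans with (1 := Rmin_r _ _), Rle_trans with (1 := Rmin_l _ _). apply Sq.
    rewrite sqrt_sqrt by apply pos_INR.
    apply le_INR in H. rewrite (mult_INR 9), E9 in H. lra.
  - apply Rle_trans with (1 := Rmin_r _ _), Rle_trans with (1 := Rmin_r _ _). apply Sq.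
    set (r := Rpower (INR G) (/ 4)).
    assert (Hr : (r * r) * (r * r) = INR G).
    { unfold r. rewrite <- !Rpower_plus. replace (/ 4 + / 4 + (/ 4 + / 4)) with 1 by field.
      apply Rpower_1. apply lt_0_INR; lia. }
    (* Here [r * r] is the square root of [G], and [G <= 9 * 4^t]; hence the square of the third
       term is at most [3 * 2^t * n]. *)
    assert (Hr3 : r * r <= 3 * INR (2 ^ t)).
    { apply Rsqr_incr_0_var; unfold Rsqr; [|pose proof (pos_INR (2 ^ t)); lra].
      rewrite Hr. apply le_INR in H.
      replace (9 * 4 ^ t)%nat with (9 * (2 ^ t * 2 ^ t))%nat in H
        by (rewrite <- Nat.pow_mul_l; reflexivity).
      rewrite !mult_INR, E9 in H. lra. }
    apply le_INR in H'. rewrite !(mult_INR), E9 in H'. rewrite mult_INR.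
    replace (INR 3) with 3 in H' by (simpl; lra).
    replace (sqrt (INR n) * r * (sqrt (INR n) * r)) with (INR n * (r * r))
      by (rewrite <- (sqrt_sqrt (INR n) (pos_INR n)) at 1; ring).
    pose proof (pos_INR n). nra.
Qed.
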